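(* For every virtual link diagram $D$ let $\Delta_D(t)\in\mathbb{Z}[t^{\pm1}]$ be its (first) Alexander polynomial derived from the virtual link group, and let $A_D(t)=\varepsilon_D t^{n_D}\Delta_D(t)$, with $\varepsilon_D\in\{-1,1\}$ and $n_D\in\mathbb{Z}$, be any choice of normalization. If $p_1(t),p_2(t),p_3(t)\in\mathbb{Z}[t^{\pm1}]$ are such that $$p_1(t)A_{D_+}(t)+p_2(t)A_{D_-}(t)+p_3(t)A_{D_0}(t)=0$$ for all skein triples $(D_+,D_-,D_0)$ of virtual link diagrams, then $p_1(t)=p_2(t)=p_3(t)=0$.
   Context: A virtual link diagram is an oriented link diagram in the plane (an oriented 4-valent plane graph, closed curves without vertices being allowed) each of whose crossings is either classical (with over/under information, hence positive or negative in the usual sense) or virtual (no over/under information). At each crossing the two strands pass transversally through each other. A skein triple $(D_+,D_-,D_0)$ consists of three virtual link diagrams that are identical except inside a small disk, where $D_+$ has a single positive classical crossing, $D_-$ a single negative classical crossing, and $D_0$ the orientation-respecting smoothing of that crossing (two disjoint arcs). The virtual link group of $D$ is given by the Wirtinger presentation: one generator for each arc of $D$ (an arc runs from one classical undercrossing to the next, passing through classical overcrossings and virtual crossings without interruption; a component with no classical undercrossing is a single arc), and one relation for each classical crossing: if $b$ is the generator of the overcrossing arc, $a$ that of the incoming and $c$ that of the outgoing undercrossing arc, then $c=bab^{-1}$ if the under strand crosses the over strand from its right side to its left side (positive crossing), and $c=b^{-1}ab$ if it crosses from left to right (negative crossing). Virtual crossings give no relations. For this presentation with $n$ generators and $m$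 relations, the Alexander matrix is the $m\times n$ matrix over $\mathbb{Z}[t^{\pm1}]$ of Fox derivatives of the relators with respect to the generators, with every generator mapped to $t$. The (first) Alexander ideal $\mathcal{E}(D)$ is the ideal generated by the $(n-1)\times(n-1)$ minors of the Alexander matrix (with the usual conventions: the ideal is $\mathbb{Z}[t^{\pm1}]$ if $n-1=0$, and $0$ if $m<n-1$), and the (first) Alexander polynomial $\Delta_D(t)$ is the greatest common divisor of $\mathcal{E}(D)$, well defined up to multiplication by $\pm t^{k}$, $k\in\mathbb{Z}$. *)

(* Defs.v *)
From HB Require Import structures.
From mathcomp Require Import all_boot all_order all_algebra.
From mathcomp Require Import boolp.

Set Implicit Arguments.
Unset Strict Implicit.
Unset Printing Implicit Defensive.

Import GRing.Theory.
Local Open Scope ring_scope.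

(* Z[t, t^-1] is realized as the subring of the fraction field of Z[t] formed
   by the fractions p / t^k. *)
Notation ratfun := {fraction {poly int}}.

Definition is_laurent : {pred ratfun} := fun x =>
  `[< exists (p : {poly int}) (k : nat), x * tofrac 'X ^+ k = tofrac p >].

Lemma is_laurentP (x : ratfun) :
  reflect (exists (p : {poly int}) (k : nat), x * tofrac 'X ^+ k = tofrac p)
          (x \in is_laurent).
Proof. exact: asboolP. Qed.

Fact is_laurent_subring : subring_closed is_laurent.
Proof.
split=> [|x y /is_laurentP[p [k Hp]] /is_laurentP[q [l Hq]]
         |x y /is_laurentP[p [k Hp]] /is_laurentP[q [l Hq]]].
- by apply/is_laurentP; exists 1, 0%N; rewrite expr0 mulr1 rmorph1.
- apply/is_laurentP; exists (p * 'X ^+ l - q * 'X ^+ k), (k + l)%N.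
  rewrite tofracB !tofracM !tofracXn -Hp -Hq exprD mulrBl; congr (_ - _).
    by rewrite mulrA.
  by rewrite mulrCA mulrC.
- apply/is_laurentP; exists (p * q), (k + l)%N.
  by rewrite tofracM -Hp -Hq exprD mulrACA.
Qed.

HB.instance Definition _ :=
  GRing.isSubringClosed.Build ratfun is_laurent is_laurent_subring.

Record laurent :=
  Laurent { laurent_val :> ratfun; _ : laurent_val \in is_laurent }.

HB.instance Definition _ := [isSub for laurent_val].
HB.instance Definition _ := [Choice of laurent by <:].
HB.instance Definition _ := [SubChoice_isSubComNzRing of laurent by <:].

Definition laurent_unit : pred laurent := fun x =>
  `[< exists y : laurent, y * x = 1 >].

Definition laurent_inv (x : laurent) : laurent :=
  if pselect (exists y : laurent, y * x = 1) is left ex then projT1 (cid ex)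
  else x.

Fact laurent_mulVx : {in laurent_unit, left_inverse 1 laurent_inv *%R}.
Proof.
move=> x /asboolP ex; rewrite /laurent_inv.
by case: pselect => // ex'; case: (cid ex').
Qed.

Fact laurent_unitPl (x y : laurent) : y * x = 1 -> laurent_unit x.
Proof. by move=> yx; apply/asboolP; exists y. Qed.

Fact laurent_inv_out : {in [predC laurent_unit], laurent_inv =1 id}.
Proof.
move=> x; rewrite inE => /asboolP ex; rewrite /laurent_inv.
by case: pselect.
Qed.

HB.instance Definition _ := GRing.ComNzRing_hasMulInverse.Build laurent
  laurent_mulVx laurent_unitPl laurent_inv_out.

Fact laurent_integral (x y : laurent) : x * y = 0 -> (x == 0) || (y == 0).
Proof.
move=> xy; rewrite -!(inj_eq val_inj) /= -mulf_eq0.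
by rewrite -[_ * _]/(val (x * y)) xy.
Qed.

HB.instance Definition _ :=
  GRing.ComUnitRing_isIntegral.Build laurent laurent_integral.

Fact tofracX_laurent : (tofrac 'X : ratfun) \in is_laurent.
Proof. by apply/is_laurentP; exists 'X, 0%N; rewrite expr0 mulr1. Qed.

Definition tL : laurent := Laurent tofracX_laurent.

Lemma tL_unit : tL \is a GRing.unit.
Proof.
have Vt : (tofrac ('X : {poly int}))^-1 \in is_laurent.
  apply/is_laurentP; exists 1, 1%N.
  by rewrite expr1 mulVf ?rmorph1 // tofrac_eq0 polyX_eq0.
apply: (@laurent_unitPl _ (Laurent Vt)); apply: val_inj => /=.
by rewrite mulVf // tofrac_eq0 polyX_eq0.
Qed.

Section Ideals.
Variable R : comNzRingType.

Definition is_minor (k m n : nat) (M : 'M[R]_(m, n)) (x : R) : Prop :=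
  exists (f : 'I_k -> 'I_m) (g : 'I_k -> 'I_n),
    [/\ {homo f : i j / (i < j)%N}, {homo g : i j / (i < j)%N}
      & x = \det (mxsub f g M)].

Definition ideal_gen (S : R -> Prop) (x : R) : Prop :=
  exists (n : nat) (c s : 'I_n -> R),
    (forall i, S (s i)) /\ x = \sum_(i < n) c i * s i.

Definition divides (d x : R) : Prop := exists c, x = c * d.

Definition is_gcd (I : R -> Prop) (d : R) : Prop :=
  (forall x, I x -> divides d x) /\
  (forall d', (forall x, I x -> divides d' x) -> divides d' d).

End Ideals.

(* The letter (g, false) is the generator g and (g, true) is its inverse. *)
Definition word (G : Type) := seq (G * bool).

(* The image in Z[t, t^-1] of the Fox derivative dw/dg under the map sending
   every generator to t: d(hw) = dh + h dw, d(h^-1 w) = - h^-1 dh + h^-1 dw. *)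
Fixpoint fox (G : eqType) (g : G) (w : word G) : laurent :=
  match w with
  | [::] => 0
  | (h, false) :: w' => (h == g)%:R + tL * fox g w'
  | (h, true) :: w' => - (tL^-1 * (h == g)%:R) + tL^-1 * fox g w'
  end.

Definition alexander_matrix (G : finType) (gens : {set G}) (rels : seq (word G))
    : 'M[laurent]_(size rels, #|gens|) :=
  \matrix_(i, j) fox (enum_val j) (nth [::] rels i).

Inductive crossing_kind := Positive | Negative | Virtual.

Notation lft := false (only parsing).
Notation rgt := true (only parsing).

(* An oriented diagram in the plane. Draw a crossing x with both strands going
   upwards: [ein (x, lft)] and [ein (x, rgt)] are the edges arriving from the
   bottom left and bottom right, [eout (x, lft)] and [eout (x, rgt)] those
   leaving to the top left and top right. The strands being transversal, one
   enters on the left and leaves on the right, the other one enters on the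
   right and leaves on the left. The edges that meet no crossing are the closed
   curves without vertices. [region] is the set of connected components of the
   complement of the diagram in the plane, [outer] is the unbounded one, and
   [side (e, s)] is the one adjacent to the oriented edge e on its side s. *)
Record diagram_data := DiagramData {
  crossing : finType;
  edge : finType;
  region : finType;
  kind : crossing -> crossing_kind;
  ein : crossing * bool -> edge;
  eout : crossing * bool -> edge;
  side : edge * bool -> region;
  outer : region
}.

Section DiagramData.
Variable D : diagram_data.
Implicit Types (x : crossing D) (e f : edge D) (p q : edge D * bool).

(* The four corners at x (left, top, right, bottom), each given by the two
   sides of edges that bound it. *)
Definition corners x : seq ((edge D * bool) * (edge D * bool)) :=
  [:: ((eout (x, lft), lft), (ein (x, lft), lft));
      ((eout (x, lft), rgt), (eout (x, rgt), lft));
      ((eout (x, rgt), rgt), (ein (x, rgt), rgt));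
      ((ein (x, lft), rgt), (ein (x, rgt), lft))].

Definition same_corner : rel (edge D * bool) := fun p q =>
  [exists x, ((p, q) \in corners x) || ((q, p) \in corners x)].

Definition endedges x : seq (edge D) :=
  [:: ein (x, lft); ein (x, rgt); eout (x, lft); eout (x, rgt)].

Definition same_crossing : rel (edge D) := fun e f =>
  [exists x, (e \in endedges x) && (f \in endedges x)].

Definition adjacent_regions : rel (region D) := fun r r' =>
  [exists p, (side p == r) && (side (p.1, ~~ p.2) == r')].

(* Let K be the number of components of the diagram, that is of
   [same_crossing]. The classes of [same_corner] are the boundary cycles of the
   faces. A component with V crossings has 2 V edges, hence at most V + 2 boundary
   cycles, with equality if and only if it is of genus 0, and a closed curve
   without vertices has two: [wf_genus0] thus says that every component is of
   genus 0. By [wf_euler] and [wf_connected], the bipartite graph whose vertices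
   are the components and the regions, with one edge for each boundary cycle, is
   connected and of Euler characteristic
   K + #|region| - (#|crossing| + 2 K) = 1. It is thus a tree, which is what an
   arrangement of the components in the sphere amounts to. *)
Record wf_diagram : Prop := WfDiagram {
  wf_ein : injective (@ein D);
  wf_eout : injective (@eout D);
  wf_ends : forall e, (e \in codom (@ein D)) = (e \in codom (@eout D));
  wf_side : forall p q, same_corner p q -> side p = side q;
  wf_genus0 : n_comp same_corner predT
              = (#|crossing D| + 2 * n_comp same_crossing predT)%N;
  wf_euler : #|region D| = (#|crossing D| + n_comp same_crossing predT).+1;
  wf_connected : forall r r' : region D, connect adjacent_regions r r'
}.

End DiagramData.

Record vdiagram := VDiagram {
  vdata :> diagram_data;
  vdata_wf : wf_diagram vdata
}.

(* A change of diagram from D to D' inside a small disk, with fV, fE and fR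
   relating the crossings, edges and regions that meet the outside of it. *)
Record outside_agree (D D' : diagram_data) (fV : crossing D' -> crossing D)
    (fE : edge D -> edge D') (fR : region D -> region D') : Prop := {
  agree_ein : forall y s, ein (y, s) = fE (ein (fV y, s));
  agree_eout : forall y s, eout (y, s) = fE (eout (fV y, s));
  agree_side : forall e s, side (fE e, s) = fR (side (e, s));
  agree_outer : outer D' = fR (outer D)
}.

Definition surj (T U : Type) (f : T -> U) : Prop := forall u, exists x, f x = u.

Definition crossing_change (D D' : diagram_data) (x : crossing D) : Prop :=
  exists (fV : crossing D' -> crossing D) (fE : edge D -> edge D')
         (fR : region D -> region D'),
    [/\ outside_agree fV fE fR,
        [/\ bijective fV, bijective fE & bijective fR],
        kind x = Positive,
        forall y, fV y = x -> kind y = Negative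
      & forall y, fV y <> x -> kind y = kind (fV y)].

(* The oriented smoothing at x joins the incoming to the outgoing edge on each
   side of x. *)
Definition smoothing_step (D : diagram_data) (x : crossing D) : rel (edge D) :=
  fun e f => [exists s, ((e == ein (x, s)) && (f == eout (x, s)))
                     || ((f == ein (x, s)) && (e == eout (x, s)))].

Definition region_above (D : diagram_data) (x : crossing D) : region D :=
  side (eout (x, lft), rgt).
Definition region_below (D : diagram_data) (x : crossing D) : region D :=
  side (ein (x, lft), rgt).

(* Smoothing x also merges the regions above and below x, if they differ, and
   no others; edges that close up at x become curves without vertices. *)
Definition smoothing (D D' : diagram_data) (x : crossing D) : Prop :=
  exists (fV : crossing D' -> crossing D) (fE : edge D -> edge D')
         (fR : region D -> region D'),
    [/\ outside_agree fV fE fR,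
        [/\ injective fV, forall y, y <> x <-> exists z, fV z = y
          & forall z, kind z = kind (fV z)],
        surj fE /\
        (forall e f, fE e = fE f <-> connect (smoothing_step x) e f)
      & surj fR /\
        (forall r s, fR r = fR s <->
           [\/ r = s, r = region_above x /\ s = region_below x
             | r = region_below x /\ s = region_above x])].

Definition skein_triple (Dp Dm D0 : vdiagram) : Prop :=
  exists x : crossing Dp, crossing_change Dm x /\ smoothing D0 x.

(* The side from which the undercrossing strand enters: at a positive crossing
   the overcrossing strand goes from bottom left to top right, at a negative
   one from bottom right to top left. *)
Definition under_side (k : crossing_kind) : option bool :=
  match k with
  | Positive => Some rgt
  | Negative => Some lft
  | Virtual => None
  end.

Section VirtualLinkGroup.
Variable D : diagram_data.
Implicit Types (x : crossing D) (e f : edge D).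

Definition arc_step : rel (edge D) := fun e f =>
  [exists x, exists s, (under_side (kind x) != Some s) &&
     (((e == ein (x, s)) && (f == eout (x, ~~ s)))
   || ((f == ein (x, s)) && (e == eout (x, ~~ s))))].

(* An arc is encoded as the set of edges of the diagram that it consists of. *)
Definition arc_of e : {set edge D} := [set f | connect arc_step e f].

Definition arcs : {set {set edge D}} := [set arc_of e | e : edge D].

(* The relators b a b^-1 c^-1 and b^-1 a b c^-1 of the relations
   c = b a b^-1 and c = b^-1 a b. *)
Definition wirtinger_relator x : option (word {set edge D}) :=
  match kind x with
  | Positive =>
      let b := arc_of (ein (x, lft)) in
      let a := arc_of (ein (x, rgt)) in
      let c := arc_of (eout (x, lft)) in
      Some [:: (b, false); (a, false); (b, true); (c, true)]
  | Negative =>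
      let b := arc_of (ein (x, rgt)) in
      let a := arc_of (ein (x, lft)) in
      let c := arc_of (eout (x, rgt)) in
      Some [:: (b, true); (a, false); (b, false); (c, true)]
  | Virtual => None
  end.

Definition wirtinger_relators : seq (word {set edge D}) :=
  pmap wirtinger_relator (enum (crossing D)).

(* When #|arcs|.-1 = 0 the only minor is the empty determinant 1, and when there
   are fewer than #|arcs|.-1 relators there is no minor at all. *)
Definition alexander_ideal : laurent -> Prop :=
  ideal_gen (is_minor #|arcs|.-1 (alexander_matrix arcs wirtinger_relators)).

Definition is_alexander_polynomial : laurent -> Prop := is_gcd alexander_ideal.

End VirtualLinkGroup.

(* Main.v *)
Require Import Defs.
From mathcomp Require Import all_boot all_order all_algebra.
From mathcomp Require Import boolp ring.

Import GRing.Theory.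
Local Open Scope ring_scope.

Set Implicit Arguments.
Unset Strict Implicit.
Unset Printing Implicit Defensive.

(** Take two round circles that meet in two crossings x and y, that is the
    closure of the 2-braid with two crossings, and put classical or virtual
    crossings of any kind at x and y ([two_circles]). Resolving x gives skein
    triples, one for each kind of y ([skein_two_circles]). The smoothing of x
    is a curl with y as its only crossing: it has a single arc, hence
    polynomial 1 ([curl_alexander]). For the other diagrams, write sgn for a
    sign, V for virtual, and list the kinds of x and y.
    - If each circle passes under at most once and x is classical, as for ++
      and -- (Hopf links), +V and -V (virtual Hopf links), then each circle is
      one arc and a relation makes the two generators commute: the polynomial
      is 1 - t ([two_circles_alexander]).
    - For +- and -+, one circle lies above the other (an unlink), and the
      polynomial is 0: the two relations are consequences of each other
      ([unlink_alexander]).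

    Up to units u of Z[t,t^-1], which also absorb the normalization, the triples
    with y positive, negative and virtual therefore give
        p1 u1 (1 - t) + p3 w1 = 0,    p2 u2 (1 - t) + p3 w2 = 0,
        p1 u3 (1 - t) + p2 u4 (1 - t) + p3 w3 = 0.
    Eliminating p1 and p2 leaves p3 times a sum of three units. A unit takes an
    odd value, 1 or -1, at t = 1, so such a sum is not 0
    ([sum3_units_neq0]). Hence p3 = 0, and then p1 = p2 = 0. *)

(** * Generators of ideals and greatest common divisors *)

(** Here d and g divide each other, so they are associates in a domain. For
    g = 0, the case of split links, this still holds. *)
Lemma is_gcd_of_mem (R : idomainType) (I : R -> Prop) (g d : R) :
  is_gcd I d -> I g -> (forall x, I x -> divides g x) ->
  exists2 u, u \is a GRing.unit & d = u * g.
Proof.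
move=> [dI dmax] /dI[e g_ed] /dmax[c d_cg].
have [g0 | g_neq0] := eqVneq g 0.
  by exists 1; rewrite ?unitr1 // d_cg g0 !mulr0.
exists c => //; apply/unitrPr; exists e.
by apply: (mulIf g_neq0); rewrite mul1r mulrAC -d_cg mulrC -g_ed.
Qed.

Lemma ideal_gen_dvd (R : comNzRingType) (S : R -> Prop) (g : R) :
  (forall x, S x -> divides g x) -> forall x, ideal_gen S x -> divides g x.
Proof.
move=> gS x [n [c [s [Ss ->]]]].
elim/big_rec: _ => [|i y _ [b ->]]; first by exists 0; rewrite mul0r.
by have [a ->] := gS _ (Ss i); exists (c i * a + b); rewrite mulrDl mulrA.
Qed.

Lemma mem_ideal_gen (R : comNzRingType) (S : R -> Prop) (c x : R) :
  S x -> ideal_gen S (c * x).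
Proof. by move=> Sx; exists 1%N, (fun=> c), (fun=> x); rewrite big_ord1. Qed.

Lemma ideal_gen0 (R : comNzRingType) (S : R -> Prop) : ideal_gen S 0.
Proof.
by exists 0%N, (fun=> 0), (fun=> 0); rewrite big_ord0; split=> // -[].
Qed.

(** * Units of Z[t, t^-1] *)

Lemma one_minus_t_neq0 : 1 - tL != 0.
Proof.
apply/eqP => /(congr1 val) /= /eqP.
rewrite subr_eq0 -(rmorph1 (@tofrac {poly int})) tofrac_eq.
by move=> /eqP /(congr1 (fun r => r.[0])); rewrite !hornerE.
Qed.

(** If u = p / t^k and u^-1 = q / t^l then p q = t^(k + l), so that p(1) is
    invertible in Z. *)
Lemma unit_eval1 (u : laurent) : u \is a GRing.unit ->
  exists (p : {poly int}) (k : nat),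
    laurent_val u * tofrac 'X ^+ k = tofrac p /\ (p.[1] = 1 \/ p.[1] = -1).
Proof.
move=> Uu; have /is_laurentP[p [k pE]] := valP u.
have /is_laurentP[q [l qE]] := valP u^-1.
exists p, k; split=> //.
have : tofrac (p * q) = tofrac ('X ^+ (k + l)) :> ratfun.
  rewrite tofracM -pE -qE mulrACA -[_ * val _]/(val (u * u^-1)) mulrV //.
  by rewrite mul1r -exprD tofracXn.
move/eqP; rewrite tofrac_eq => /eqP /(congr1 (fun r => r.[1])).
rewrite hornerM hornerXn expr1n mulrC => /intUnitRing.unitzPl.
by case/orP=> /eqP; [left | right].
Qed.

(** At t = 1 the sum is odd. *)
Lemma sum3_units_neq0 (u v w : laurent) :
  u \is a GRing.unit -> v \is a GRing.unit -> w \is a GRing.unit ->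
  u + v + w != 0.
Proof.
move=> /unit_eval1[p [i [pE p1]]] /unit_eval1[q [j [qE q1]]].
move=> /unit_eval1[r [k [rE r1]]]; apply/eqP => sum0.
have {}sum0 : val u + val v + val w = 0 := congr1 val sum0.
have : tofrac (p * 'X^(j + k) + q * 'X^(i + k) + r * 'X^(i + j)) = 0 :> ratfun.
  rewrite !tofracD !tofracM -pE -qE -rE !tofracXn !exprD.
  rewrite -[RHS](mul0r (tofrac 'X ^+ i * tofrac 'X ^+ j * tofrac 'X ^+ k)).
  by rewrite -sum0 /=; ring.
move/eqP; rewrite tofrac_eq0 => /eqP /(congr1 (fun r => r.[1])).
rewrite !hornerE !expr1n !mulr1.
by case: p1 => ->; case: q1 => ->; case: r1 => ->.
Qed.

(** * Fox derivatives of Wirtinger relators and small minors *)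

Section FoxCalculus.
Variable G : finType.
Implicit Types g a b c : G.

Let tV : tL * tL^-1 = 1 := mulrV tL_unit.

Lemma fox_positive g a b c :
  fox g [:: (b, false); (a, false); (b, true); (c, true)] =
  (1 - tL) * (b == g)%:R + tL * (a == g)%:R - (c == g)%:R.
Proof. by rewrite /= mulr0 addr0; ring: tV. Qed.

Lemma fox_negative g a b c :
  fox g [:: (b, true); (a, false); (b, false); (c, true)] =
  (1 - tL^-1) * (b == g)%:R + tL^-1 * (a == g)%:R - (c == g)%:R.
Proof. by rewrite /= mulr0 addr0; ring: tV. Qed.

(** The relations a = b c b^-1 and c = b^-1 a b are equivalent: the relator of
    one is conjugate to the inverse of that of the other, by a word that maps
    to t, whence proportional Fox derivatives. *)
Lemma fox_inverse_relations g a b c :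
  fox g [:: (b, false); (c, false); (b, true); (a, true)] =
  - tL * fox g [:: (b, true); (a, false); (b, false); (c, true)].
Proof. by rewrite fox_positive fox_negative; ring: tV. Qed.

Variables (gens : {set G}) (rels : seq (word G)).
Let M := alexander_matrix gens rels.

Lemma is_minor0 : is_minor 0 M 1.
Proof.
have f m : 'I_0 -> 'I_m by case.
by exists (f _), (f _); rewrite det_mx00; split=> // -[].
Qed.

Lemma is_minor1 x :
  is_minor 1 M x <-> exists g w, [/\ g \in gens, w \in rels & x = fox g w].
Proof.
split=> [[f [g [_ _ ->]]] | [g [w [gens_g rels_w ->]]]].
  exists (enum_val (g ord0)), (nth [::] rels (f ord0)).
  by rewrite enum_valP mem_nth // [mxsub _ _ _]mx11_scalar det_scalar1 !mxE.
have lt_w : (index w rels < size rels)%N by rewrite index_mem.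
exists (fun=> Ordinal lt_w), (fun=> enum_rank_in gens_g g).
split=> [i j|i j|]; rewrite ?(ord1 i) ?(ord1 j) //.
by rewrite [mxsub _ _ _]mx11_scalar det_scalar1 !mxE enum_rankK_in // nth_index.
Qed.

(** When all relators have proportional Fox derivatives, the Alexander matrix
    has rank at most 1. *)
Lemma is_minor2_rank1 (r : G -> laurent) x :
    (forall w, w \in rels -> exists z, forall g, fox g w = z * r g) ->
  is_minor 2 M x -> x = 0.
Proof.
move=> rk1 [f [g [_ _ ->]]].
have row i : exists z, forall j, mxsub f g M i j = z * r (enum_val (g j)).
  have [|z zE] := rk1 (nth [::] rels (f i)); first exact: mem_nth.
  by exists z => j; rewrite !mxE zE.
have [z zE] := choice row.
have -> : mxsub f g M
          = diag_mx (\row_i z i) *m \matrix_(i, j) r (enum_val (g j)).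
  by apply/matrixP=> i j; rewrite zE mul_diag_mx !mxE.
rewrite det_mulmx.
rewrite [X in _ * X](determinant_alternate (_ : ord0 != ord_max)) ?mulr0 //.
by move=> j; rewrite !mxE.
Qed.

End FoxCalculus.

(** * Counting the classes of a relation by means of labels *)

Section Labels.
Variables (T U : finType) (e : rel T) (lab : T -> U).

Lemma connect_labelP :
    (forall x y, e x y -> lab x = lab y) ->
    (forall x y, lab x = lab y -> connect e x y) ->
  forall x y, connect e x y = (lab x == lab y).
Proof.
move=> e_lab lab_e x y; apply/idP/eqP; last exact: lab_e.
case/connectP=> p; elim: p x => [|z p IHp] x /=; first by move=> _ ->.
by case/andP=> /e_lab -> /IHp.
Qed.

Lemma n_comp_label :
    (forall x y, connect e x y = (lab x == lab y)) ->
    (forall u, exists x, lab x = u) ->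
  n_comp e predT = #|U|.
Proof.
move=> labP lab_surj.
have symE : connect_sym e by move=> x y; rewrite !labP eq_sym.
have -> : #|U| = #|lab @: [set x | roots e x]|.
  rewrite -cardsT; apply: eq_card => u; rewrite inE; apply/esym/imsetP.
  have [x <-] := lab_surj u.
  exists (fingraph.root e x); first by rewrite inE roots_root.
  by apply/eqP; rewrite -labP connect_root.
rewrite card_in_imset => [|x y]; last first.
  rewrite !inE => /eqP rx /eqP ry /eqP; rewrite -labP => /(fingraph.rootP symE).
  by rewrite rx ry.
by apply: eq_card => x; rewrite !inE andbT.
Qed.

End Labels.

(** * Closures of 2-braids *)

Section BraidClosure.
Variables (C : finType) (prev : C -> C) (k : C -> crossing_kind).

(** The closure of a 2-braid whose crossings, read upwards, succeed each other
    in the cyclic order of which [prev] is the predecessor function. The edge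
    (c, s) leaves c on the side s. The regions inl lft and inl rgt lie on the
    left and on the right of the whole braid, and inr c is the bigon on top of
    c (for a single crossing, the disk that has both the top and the bottom
    corner). *)
Definition braid_closure : diagram_data := {|
  crossing := C;
  edge := (C * bool)%type;
  region := (bool + C)%type;
  kind := k;
  ein := fun p => (prev p.1, p.2);
  eout := id;
  side := fun q => if q.1.2 == q.2 then inl q.2 else inr q.1.1;
  outer := inl lft
|}.

Hypothesis prev_inj : injective prev.
Hypothesis prev_connected : forall c d, connect (frel prev) c d.
Variable c0 : C.

Let D := braid_closure.

Lemma closure_corner (p q : edge D * bool) : same_corner p q -> side p = side q.
Proof.
case/existsP=> x; rewrite !inE /=.
by case/orP=> /or4P[] /eqP[-> ->].
Qed.

(** Each region is a disk of the sphere, hence has a single boundary cycle. *)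
Lemma closure_same_corner (p q : edge D * bool) :
  connect (@same_corner D) p q = (side p == side q).
Proof.
move: p q; apply: connect_labelP => [|]; first exact: closure_corner.
have corner1 x p1 p2 : (p1, p2) \in corners (x : crossing D) ->
    connect (@same_corner D) p1 p2 /\ connect (@same_corner D) p2 p1.
  by move=> xpq; split; apply/connect1/existsP; exists x; rewrite xpq ?orbT.
have strand s c d : connect (@same_corner D) ((c, s), s) ((d, s), s).
  have /connectP[p + ->] := prev_connected c d.
  elim: p c => [|c' p IHp] c /=; first by rewrite connect0.
  case/andP=> /eqP <- /IHp; apply: connect_trans.
  by apply: (corner1 c _ _ _).1; rewrite !inE; case: (s); rewrite eqxx ?orbT.
move=> [[c s] u] [[d s'] u'] /=.
case: eqP => [<-|su]; case: eqP => [<-|su'] // -[<-]; first exact: strand.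
have [-> ->] : u = ~~ s /\ u' = ~~ s' by case: s s' u u' su su' => [] [] [] [].
case: s s' {su su'} => [] []; rewrite ?connect0 //.
  by apply: (corner1 c _ _ _).2; rewrite !inE eqxx ?orbT.
by apply: (corner1 c _ _ _).1; rewrite !inE eqxx ?orbT.
Qed.

Lemma closure_same_crossing (e f : edge D) : connect (@same_crossing D) e f.
Proof.
have step x g h : g \in endedges (x : crossing D) -> h \in endedges x ->
    connect (@same_crossing D) g h.
  by move=> xg xh; apply/connect1/existsP; exists x; rewrite xg.
case: e f => c s [d s'].
have /connectP[p + ->] := prev_connected c d.
elim: p c s => [|c' p IHp] c s /=.
  move=> _; apply: (step c); rewrite !inE; [case: s | case: s'];
  by rewrite eqxx ?orbT.
case/andP=> /eqP <- /(IHp _ s); apply: connect_trans.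
by apply: (step c); rewrite !inE; case: s; rewrite eqxx ?orbT.
Qed.

Lemma closure_wf : wf_diagram D.
Proof.
have n_crossing : n_comp (@same_crossing D) predT = 1%N.
  rewrite -card_unit; apply: (n_comp_label (lab := fun=> tt)) => [e f | []].
    by rewrite closure_same_crossing eqxx.
  by exists (c0, lft).
split.
- by move=> [c s] [d s'] [/prev_inj -> ->].
- exact: inj_id.
- move=> [c s]; rewrite [RHS](_ : _ = true); last by apply/codomP; exists (c, s).
  by apply/codomP; exists (finv prev c, s); rewrite /= f_finv.
- exact: closure_corner.
- rewrite (n_comp_label closure_same_corner) => [|[s|c]].
  + by rewrite n_crossing card_sum card_bool addnC.
  + by exists ((c0, s), s); rewrite /= eqxx.
  + by exists ((c, lft), rgt).
- by rewrite n_crossing card_sum card_bool addn1.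
- suff to_left r : connect (@adjacent_regions D) r (inl lft)
                /\ connect (@adjacent_regions D) (inl lft) r.
    by move=> r r'; apply: connect_trans (to_left r).1 (to_left r').2.
  have adj c s : connect (@adjacent_regions D) (inl s) (inr c)
               /\ connect (@adjacent_regions D) (inr c) (inl s).
    split; apply/connect1/existsP;
      [exists ((c, s), s) | exists ((c, s), ~~ s)];
    by case: s; rewrite /= !eqxx.
  case: r => [s | c]; last exact: (conj (adj c lft).2 (adj c lft).1).
  by split; [apply: connect_trans (adj c0 s).1 (adj c0 lft).2
            |apply: connect_trans (adj c0 lft).1 (adj c0 s).2].
Qed.

End BraidClosure.

Lemma connect_negb (c d : bool) : connect (frel negb) c d.
Proof.
have [->|] := eqVneq c d; first exact: connect0.
by move=> cd; apply: connect1; case: c d cd => [] [].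
Qed.

Lemma connect_unit (c d : unit) : connect (frel id) c d.
Proof. by case: c; case: d; apply: connect0. Qed.

(** The crossing x is [true] and y is [false]. The two circles are the sets of
    edges (c, s) with c (+) s = false and c (+) s = true. *)
Definition two_circles (kx ky : crossing_kind) : vdiagram :=
  VDiagram (closure_wf (fun c : bool => if c then kx else ky)
              negb_inj connect_negb true).

Definition curl (k : crossing_kind) : vdiagram :=
  VDiagram (closure_wf (fun=> k) (@inj_id unit) connect_unit tt).

Lemma skein_two_circles (ky : crossing_kind) :
  skein_triple (two_circles Positive ky) (two_circles Negative ky) (curl ky).
Proof.
exists true; split.
  exists id, id, id; split=> //.
  - by split; exists id.
  - by move=> y ->.
  - by case.
(* Smoothing x joins the two edges on either side of the braid, and merges the
   two bigons. *)
exists (fun=> false), (fun e => (tt, e.2)),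
  (fun r => match r with inl s => inl s | inr _ => inr tt end).
split.
- by split=> [[] s|[] s|[c s] u|] //=; case: ifP.
- split=> [[] []||] //.
  by case; split=> //; by [case | exists tt].
- split=> [[[] s]|]; first by exists (true, s).
  have stepP (e f : bool * bool) :
      connect (smoothing_step (true : crossing (two_circles Positive ky))) e f
      = (e.2 == f.2).
    move: e f; apply: connect_labelP => [e f | [c s] [d s'] /= <-].
      by case/existsP=> s /orP[] /andP[/eqP -> /eqP ->].
    have [-> | cd] := eqVneq c d; first exact: connect0.
    apply/connect1/existsP; exists s.
    by case: c d cd => [] [] // _; rewrite /= !eqxx ?orbT.
  by move=> e f; rewrite stepP; split=> [[->] | /eqP ->].
- split=> [[s | []]|]; [by exists (inl s) | by exists (inr true) |].
  move=> [s | c] [s' | d]; rewrite /region_above /region_below /=.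
  + by split=> [[->] | [[->]|[]|[]]] //; apply: Or31.
  + by split=> // -[|[]|[]].
  + by split=> // -[|[]|[]].
  + split=> // _; case: c d => [] [];
    by [apply: Or31 | apply: Or32 | apply: Or33].
Qed.

(** * Arcs and Alexander polynomials of a diagram *)

Section Arcs.
Variable D : diagram_data.

Lemma connect_arc_sym : connect_sym (@arc_step D).
Proof.
apply: sym_connect_sym => e f.
by apply: eq_existsb => x; apply: eq_existsb => s; rewrite orbC.
Qed.

Lemma arc_through (x : crossing D) s : under_side (kind x) != Some s ->
  connect (@arc_step D) (ein (x, s)) (eout (x, ~~ s)).
Proof.
move=> xs; apply/connect1/existsP; exists x; apply/existsP; exists s.
by rewrite xs !eqxx.
Qed.

Lemma arcsP (A : {set edge D}) :
  reflect (exists e, A = arc_of e) (A \in arcs D).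
Proof. by apply: (iffP imsetP) => [[e _ ->]|[e ->]]; exists e. Qed.

Lemma mem_relators w :
  w \in wirtinger_relators D <->
  exists x : crossing D, wirtinger_relator x = Some w.
Proof.
rewrite mem_pmap; split=> [/mapP[x _ xw] | [x xw]]; first by exists x.
by apply/mapP; exists x; rewrite ?mem_enum.
Qed.

Variables (L : finType) (lab : edge D -> L).
Hypothesis labP : forall e f, connect (@arc_step D) e f = (lab e == lab f).

Lemma arc_of_label e f : (arc_of e == arc_of f) = (lab e == lab f).
Proof.
rewrite -labP; apply/eqP/idP => [ef | ef].
  by have : f \in arc_of e by [rewrite ef inE connect0]; rewrite inE.
by apply/setP=> g; rewrite !inE !labP; move: ef; rewrite labP => /eqP ->.
Qed.

Lemma card_arcs : (forall l, exists e, lab e = l) -> #|arcs D| = #|L|.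
Proof.
move=> /choice[pick pickK].
have -> : arcs D = [set arc_of (pick l) | l : L].
  apply/setP=> A; apply/imsetP/imsetP => -[e _ ->].
    by exists (lab e) => //; apply/eqP; rewrite arc_of_label pickK.
  by exists (pick e).
rewrite card_imset // => l l' /eqP.
by rewrite arc_of_label !pickK => /eqP.
Qed.

End Arcs.

Section AlexanderPolynomial.
Variables (D : diagram_data) (d : laurent).
Hypothesis dP : is_alexander_polynomial D d.

Lemma alexander_gcd n : #|arcs D| = n.+1 ->
  is_gcd (ideal_gen (is_minor n
            (alexander_matrix (arcs D) (wirtinger_relators D)))) d.
Proof. by move=> arcs_n; rewrite -/(n.+1.-1) -arcs_n; exact: dP. Qed.

Lemma alexander_one_arc : #|arcs D| = 1%N -> d \is a GRing.unit.
Proof.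
move=> /alexander_gcd gcd_d.
have [||u Uu ->] := is_gcd_of_mem (g := 1) gcd_d; last by rewrite mulr1.
  by rewrite -[1]mulr1; apply/mem_ideal_gen/is_minor0.
by move=> x _; exists x; rewrite mulr1.
Qed.

Lemma alexander_two_arcs (g : laurent) (e : edge D) w :
    #|arcs D| = 2%N ->
    (forall f v, v \in wirtinger_relators D -> divides g (fox (arc_of f) v)) ->
    w \in wirtinger_relators D -> divides (fox (arc_of e) w) g ->
  exists2 u, u \is a GRing.unit & d = u * g.
Proof.
move=> /alexander_gcd gcd_d g_dvd w_rel [c gE].
apply: is_gcd_of_mem gcd_d _ _.
  rewrite gE; apply/mem_ideal_gen/is_minor1; exists (arc_of e), w; split=> //.
  by apply/arcsP; exists e.
apply: ideal_gen_dvd => _ /is_minor1[_ [v [/arcsP[f ->] v_rel ->]]].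
exact: g_dvd.
Qed.

Lemma alexander_three_arcs (r : {set edge D} -> laurent) :
    #|arcs D| = 3 ->
    (forall w, w \in wirtinger_relators D ->
       exists c, forall A, fox A w = c * r A) ->
  d = 0.
Proof.
move=> /alexander_gcd gcd_d rk1.
have [||u _ ->] := is_gcd_of_mem (g := 0) gcd_d; last by rewrite mulr0.
  exact: ideal_gen0.
apply: ideal_gen_dvd => x /(is_minor2_rank1 rk1) ->.
by exists 0; rewrite mulr0.
Qed.

End AlexanderPolynomial.

(** * The polynomials of the three families *)

(** Whatever its kind, the crossing lets at least one of its strands through,
    and this strand joins the two edges. *)
Lemma curl_alexander k d : is_alexander_polynomial (curl k) d ->
  d \is a GRing.unit.
Proof.
move/alexander_one_arc; apply; set D := curl k.
have joined : connect (@arc_step D) (tt, lft) (tt, rgt).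
  have [H | H] := boolP (under_side k != Some lft).
    exact: (@arc_through D tt lft H).
  rewrite connect_arc_sym; apply: (@arc_through D tt rgt).
  by change (under_side k != Some rgt); case: (k) H.
have labP : forall e f, connect (@arc_step D) e f = (tt == tt).
  apply: (connect_labelP (lab := fun=> tt)) => // e f _.
  by case: e f => [[] []] [[] []]; rewrite ?connect0 // connect_arc_sym.
by rewrite (card_arcs labP) ?card_unit // => -[]; exists (tt, lft).
Qed.

(** The circle c (+) s = false enters x from the left and y from the right,
    the other one enters x from the right and y from the left. *)
Definition each_under_at_most_once (kx ky : crossing_kind) : bool :=
  ((under_side kx != Some lft) || (under_side ky != Some rgt)) &&
  ((under_side kx != Some rgt) || (under_side ky != Some lft)).

Lemma two_circles_arcs kx ky (D := two_circles kx ky) :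
    each_under_at_most_once kx ky ->
  forall e f : edge D,
    connect (@arc_step D) e f = (e.1 (+) e.2 == f.1 (+) f.2).
Proof.
case/andP=> Hf Ht; apply: connect_labelP.
  move=> [c s] [d s'] /existsP[x /existsP[u /andP[_]]].
  by case: x u c s d s' => [] [] [] [] [] [].
(* A circle with one undercrossing at most passes uninterrupted through x or
   through y, and this joins its two edges. *)
have yx s : connect (@arc_step D) (false, s) (true, ~~ s).
  case: s; [case/orP: Ht => H | case/orP: Hf => H].
  - exact: (@arc_through D true rgt H).
  - by rewrite connect_arc_sym; exact: (@arc_through D false lft H).
  - exact: (@arc_through D true lft H).
  - by rewrite connect_arc_sym; exact: (@arc_through D false rgt H).
have xy s : connect (@arc_step D) (true, s) (false, ~~ s).
  by rewrite connect_arc_sym -{2}[s]negbK; apply: yx.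
move=> [c s] [d s'] /=.
by case: c d s s' => [] [] [] [] // _; rewrite ?connect0 // ?yx ?xy.
Qed.

(** At each classical crossing the incoming and outgoing undercrossing arcs
    coincide, so each relator is a commutator of the two generators, up to
    conjugation and inversion. *)
Lemma two_circles_alexander kx ky d :
    each_under_at_most_once kx ky -> kx <> Virtual ->
    is_alexander_polynomial (two_circles kx ky) d ->
  exists2 u, u \is a GRing.unit & d = u * (1 - tL).
Proof.
move=> /two_circles_arcs labP kxV dP; set D := two_circles kx ky in dP labP *.
have tV : tL * tL^-1 = 1 := mulrV tL_unit.
have arcE (c c' s s' : bool) :
    (arc_of ((c, s) : edge D) == arc_of ((c', s') : edge D))
    = (c (+) s == c' (+) s').
  exact: (arc_of_label labP).
have dvd f v : v \in wirtinger_relators D ->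
    divides (1 - tL) (fox (arc_of f) v).
  case: f => d' u /mem_relators[x]; rewrite /wirtinger_relator.
  case: (kind x) => // -[<-]; rewrite ?fox_positive ?fox_negative /= !arcE.
    rewrite !addbT !addbF negbK; set b := (_ == _)%:R; set a := (_ == _)%:R.
    by exists (b - a); ring.
  rewrite !addbT !addbF negbK; set b := (_ == _)%:R; set a := (_ == _)%:R.
  by exists (- tL^-1 * (b - a)); ring: tV.
have {}kxV : kind (true : crossing D) <> Virtual := kxV.
have [w wE] : exists w, wirtinger_relator (true : crossing D) = Some w.
  by rewrite /wirtinger_relator; case: kind kxV => // _; eexists.
apply: (alexander_two_arcs dP (e := (false, lft)) _ dvd (w := w)).
- rewrite (card_arcs labP) ?card_bool // => l.
  by exists (l, false); rewrite addbF.
- by apply/mem_relators; exists true.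
move: wE; rewrite /wirtinger_relator.
case: kind kxV => // _ [<-]; rewrite ?fox_positive ?fox_negative /=.
  by rewrite !arcE /= mulr1n mulr0n; exists 1; ring.
by rewrite !arcE /= mulr1n mulr0n; exists tL; ring: tV.
Qed.

(** The negative crossing is [u] and the circle on top is c (+) s = u. *)
Definition unlink (u : bool) : vdiagram :=
  two_circles (if u then Negative else Positive)
              (if u then Positive else Negative).

(** The circle on top is one arc, with label None. Both edges of the other one
    are arcs. *)
Definition unlink_label (u : bool) (e : bool * bool) : option bool :=
  if e.1 (+) e.2 == u then None else Some e.1.

Lemma unlink_arcs u (e f : edge (unlink u)) :
  connect (@arc_step (unlink u)) e f = (unlink_label u e == unlink_label u f).
Proof.
move: e f; apply: connect_labelP.
  move=> [c s] [d s'] /existsP[x /existsP[v]].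
  by case: u x v c s d s' => [] [] [] [] [] [] [].
have over : connect (@arc_step (unlink u)) (false, u) (true, ~~ u).
  by apply: (@arc_through (unlink u) true u); case: u.
move=> [c s] [d s'].
by case: u c d s s' over => [] [] [] [] [] // over _;
   rewrite ?connect0 // connect_arc_sym.
Qed.

(** With b the arc on top, the lower circle goes from its arc a to its arc c at
    one crossing and from c to a at the other one, which undoes the conjugation
    by b. *)
Lemma unlink_alexander u d : is_alexander_polynomial (unlink u) d -> d = 0.
Proof.
move=> dP; set D := unlink u in dP *.
pose arc e := arc_of (e : edge D).
pose a := arc (~~ u, lft); pose b := arc (~~ u, rgt); pose c := arc (u, rgt).
have on_top : arc (u, lft) = b.
  by apply/eqP; rewrite (arc_of_label (@unlink_arcs u)); case: (u).
pose w : word {set edge D} := [:: (b, true); (a, false); (b, false); (c, true)].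
have relator_neg : wirtinger_relator (u : crossing D) = Some w.
  by rewrite /w /a /b /c /arc /D; case: (u).
have relator_pos : wirtinger_relator (~~ u : crossing D)
                   = Some [:: (b, false); (c, false); (b, true); (a, true)].
  by rewrite -on_top /a /c /arc /D; case: (u).
apply: (alexander_three_arcs dP (r := fun A => fox A w)).
  rewrite (card_arcs (@unlink_arcs u)) ?card_option ?card_bool // => -[l|].
    by exists (l, ~~ (l (+) u)); case: (u) l => [] [].
  by exists (u, false); rewrite /unlink_label addbF eqxx.
have or_neg (y : bool) : y = u \/ y = ~~ u by case: y (u) => [] []; auto.
move=> v /mem_relators[x]; case: (or_neg x) => ->.
  by rewrite relator_neg => -[<-]; exists 1 => A; rewrite mul1r.
rewrite relator_pos => -[<-].
by exists (- tL) => A; apply: fox_inverse_relations.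
Qed.

Theorem theorem7 (Delta A : vdiagram -> laurent)
    (hDelta : forall D : vdiagram, is_alexander_polynomial D (Delta D))
    (hA : forall D : vdiagram, exists (eps : laurent) (n : int),
       (eps = -1 \/ eps = 1) /\ A D = eps * tL ^ n * Delta D)
    (p1 p2 p3 : laurent)
    (hskein : forall Dp Dm D0 : vdiagram, skein_triple Dp Dm D0 ->
       p1 * A Dp + p2 * A Dm + p3 * A D0 = 0) :
  p1 = 0 /\ p2 = 0 /\ p3 = 0.
Proof.
have A_unit D : exists2 u, u \is a GRing.unit & A D = u * Delta D.
  have [eps [n [eps1 ->]]] := hA D; exists (eps * tL ^ n) => //.
  rewrite unitrM unitrXz ?tL_unit // andbT.
  by case: eps1 => ->; rewrite ?unitrN unitr1.
have A_hopf kx ky : each_under_at_most_once kx ky -> kx <> Virtual ->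
    exists2 u, u \is a GRing.unit & A (two_circles kx ky) = u * (1 - tL).
  move=> H kxV; have [u Uu ->] := A_unit (two_circles kx ky).
  have [v Uv ->] := two_circles_alexander H kxV (hDelta _).
  by exists (u * v); rewrite ?unitrM ?Uu ?mulrA.
have A_curl ky : A (curl ky) \is a GRing.unit.
  have [u Uu ->] := A_unit (curl ky).
  by rewrite unitrM Uu (curl_alexander (hDelta _)).
have A_unlink u : A (unlink u) = 0.
  have [v _ ->] := A_unit (unlink u).
  by rewrite (unlink_alexander (hDelta _)) mulr0.
have skein ky := hskein _ _ _ (skein_two_circles ky).
have := skein Positive; have := skein Negative; have := skein Virtual.
rewrite (A_unlink false : A (two_circles Positive Negative) = 0).
rewrite (A_unlink true : A (two_circles Negative Positive) = 0).
rewrite !mulr0 addr0 add0r.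
have [//|uPP UPP ->] := A_hopf Positive Positive isT.
have [//|uNN UNN ->] := A_hopf Negative Negative isT.
have [//|uPV UPV ->] := A_hopf Positive Virtual isT.
have [//|uNV UNV ->] := A_hopf Negative Virtual isT.
move: (A_curl Positive) (A_curl Negative) (A_curl Virtual).
move: (A (curl Positive)) (A (curl Negative)) (A (curl Virtual)).
move=> wP wN wV UwP UwN UwV skV skN skP.
have VPP : uPP * uPP^-1 = 1 := mulrV UPP.
have VNN : uNN * uNN^-1 = 1 := mulrV UNN.
have p3_0 : p3 = 0.
  have : p3 * (wV + - (wP * uPV / uPP) + - (wN * uNV / uNN)) = 0.
    transitivity (p1 * (uPV * (1 - tL)) + p2 * (uNV * (1 - tL)) + p3 * wV
      - uPV / uPP * (p1 * (uPP * (1 - tL)) + p3 * wP)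
      - uNV / uNN * (p2 * (uNN * (1 - tL)) + p3 * wN)); first by ring: VPP VNN.
    by rewrite skV skN skP !mulr0 !subr0.
  move/eqP; rewrite mulf_eq0 (negPf (sum3_units_neq0 _ _ _)) ?orbF //.
  - by move/eqP.
  - by rewrite unitrN !unitrM unitrV UwP UPV.
  - by rewrite unitrN !unitrM unitrV UwN UNV.
have cancel p u : u \is a GRing.unit -> p * (u * (1 - tL)) = 0 -> p = 0.
  move=> Uu pu0; apply: (mulIf one_minus_t_neq0); apply: (mulIr Uu).
  by rewrite !mul0r -mulrA [_ * u]mulrC.
split; [|split] => //.
  by apply: cancel UPP _; rewrite -skP p3_0 mul0r addr0.
by apply: cancel UNN _; rewrite -skN p3_0 mul0r addr0.
Qed.
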